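(* Let $0<\alpha\le 1$, let $X,Y$ be Banach spaces and let $u:\mathbb{R}_{\ge 0}\to\mathcal{L}(X;Y)$ be a function. Then the following are equivalent: (a) for each $x\in X$ there is $t_x\ge 0$ such that the orbit $u_x$ is locally $\alpha$-Hölder continuous on $(t_x,\infty)$; (b) there is $t\ge 0$ such that for all $x\in X$ the orbit $u_x$ is locally $\alpha$-Hölder continuous on $(t,\infty)$.
   Context: $X,Y$ are Banach spaces over the same field $\mathbb{R}$ or $\mathbb{C}$; $\mathcal{L}(X;Y)$ is the space of bounded linear operators from $X$ to $Y$; $\mathbb{R}_{\ge 0}=[0,\infty)$. No continuity or other regularity of $u$ is assumed. For $x\in X$, the orbit is the function $u_x:\mathbb{R}_{\ge 0}\to Y$, $u_x(t)=u(t)x$. A function $f$ is locally $\alpha$-Hölder continuous on an interval $J$ if for every compact subinterval $K\subseteq J$ one has $\sup\{\|f(s)-f(r)\|/(s-r)^\alpha : r,s\in K,\ r<s\}<\infty$. *)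

(* Defs.v *)
From HB Require Import structures.
From mathcomp Require Import all_boot all_order all_algebra.
From mathcomp Require Import complex.
From mathcomp Require Import all_classical all_reals all_analysis.

Set Implicit Arguments.
Unset Strict Implicit.
Unset Printing Implicit Defensive.

Import Order.TTheory GRing.Theory Num.Theory.
Import numFieldNormedType.Exports.

Local Open Scope classical_set_scope.
Local Open Scope ring_scope.
Local Open Scope complex_scope.

Variant scalars := RealScalars | ComplexScalars.

Definition scalar_field (R : realType) (k : scalars) : numFieldType :=
  match k with
  | RealScalars => (R : numFieldType)
  | ComplexScalars => (R[i] : numFieldType)
  end.

Definition scalar_of_real (R : realType) (k : scalars) :
    R -> scalar_field R k :=
  match k return R -> scalar_field R k with
  | RealScalars => fun a => a
  | ComplexScalars => fun a => a%:C
  end.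

Definition scalar_Re (R : realType) (k : scalars) :
    scalar_field R k -> R :=
  match k return scalar_field R k -> R with
  | RealScalars => fun a => a
  | ComplexScalars => fun a => complex.Re a
  end.

(* The norm of a [normedModType K] takes its values in [K]; when [K] is [R[i]]
   these values are real and nonnegative, and [rnorm] reads them in [R]. *)
Definition rnorm (R : realType) (k : scalars)
    (V : normedModType (scalar_field R k)) (v : V) : R :=
  scalar_Re `|v|.

Lemma scalar_of_real_rnorm (R : realType) (k : scalars)
    (V : normedModType (scalar_field R k)) (v : V) :
  scalar_of_real k (rnorm v) = `|v|.
Proof.
rewrite /rnorm; have := normr_ge0 v; move: `|v|.
case: k V v => //= _ _ [a b].
by rewrite lecE /= => /andP[/eqP -> _].
Qed.

Record bounded_linear (R : realType) (k : scalars)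
    (X Y : normedModType (scalar_field R k)) := BoundedLinear {
  bounded_linear_fun :> {linear X -> Y} ;
  bounded_linearP :
    exists C : R, forall x : X, rnorm (bounded_linear_fun x) <= C * rnorm x }.

Definition orbit_at (R : realType) (k : scalars)
    (X Y : normedModType (scalar_field R k))
    (u : {nonneg R} -> bounded_linear X Y) (x : X) : {nonneg R} -> Y :=
  fun t => u t x.

Definition hoelder_quotients (R : realType) (k : scalars)
    (Y : normedModType (scalar_field R k)) (alpha : R) (K : set R)
    (f : {nonneg R} -> Y) : set R :=
  [set q | exists r s : {nonneg R},
     [/\ K r%:num, K s%:num, r%:num < s%:num &
         q = rnorm (f s - f r) / (s%:num - r%:num) `^ alpha]].

(* The supremum is taken in the extended reals, with value [-oo] when [K] does
   not contain two distinct points. *)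
Definition locally_hoelder_on (R : realType) (k : scalars)
    (Y : normedModType (scalar_field R k)) (alpha : R) (J : set R)
    (f : {nonneg R} -> Y) : Prop :=
  forall K : set R, compact K -> is_interval K -> K `<=` J ->
    (ereal_sup (EFin @` hoelder_quotients alpha K f) < +oo)%E.

(* Main.v *)
Require Import Defs.
From HB Require Import structures.
From mathcomp Require Import all_boot all_order all_algebra.
From mathcomp Require Import complex.
From mathcomp Require Import all_classical all_reals all_analysis.

Set Implicit Arguments.
Unset Strict Implicit.
Unset Printing Implicit Defensive.

Import Order.TTheory GRing.Theory Num.Theory.
Import numFieldNormedType.Exports.

Local Open Scope classical_set_scope.
Local Open Scope ring_scope.

(** Only the passage from individual times to a common one needs an argument,
and it is a Baire category argument.  On a fixed compact interval [K], the
[alpha]-Hoelder property of the orbit of [x] says that the difference quotients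
[(u s - u r) / (s - r) ^ alpha], for [r < s] in [K], which form a family of
continuous linear operators, are bounded at [x].  If no common time existed,
then for every integer [n] some compact interval [K n] beyond [n] would carry a
family [T n] of difference quotients that is unbounded at some vector.  On the
other hand each [x] has a Hoelder orbit after some time, so [T n] is bounded at
[x] as soon as [n] exceeds that time.

This is excluded by the following principle of condensation of singularities
([condensation_bounded]): if every vector of a Banach space is a point of
boundedness of one of the countably many families [T n], then a single [T n] is
bounded at every vector.  Indeed the closed sets
[F (n, c) = {x | |f x| <= c for all f in T n}] cover the space, so one of them
contains a ball; as the operators are linear, a bound for [T n] on a ball gives
a bound at every vector.

The norms of a complex normed space take their values in [R[i]], which is only
partially ordered.  Baire's theorem ([baire_closed_cover]) is therefore proved
over an arbitrary number field in which the inverses of the integers tend to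
[0], and this covers real and complex scalars at once. *)

(** * Baire's theorem over an archimedean number field *)

(** The inverses of the integers are used, rather than an upper bound for every
element, because elements of [R[i]] that are not real are below no integer. *)
Definition archimedean_scale (K : numFieldType) : Prop :=
  forall e : K, 0 < e -> exists n : nat, n.+1%:R^-1 < e.

(** The order of [K] may be partial, so a violated inequality cannot be turned
into a strict opposite one; the bound is obtained up to every [e > 0] instead. *)
Lemma closed_dist_le (K : numFieldType) (V : normedModType K) (a : V) (c : K) :
  closed [set y : V | `|a - y| <= c].
Proof.
move=> y cly; apply/ler_addgt0Pr => e e0.
have [z [/= azc yz]] := cly _ (nbhsx_ballx y e e0).
rewrite -(subrK z a) -addrA (le_trans (ler_normD _ _))// lerD//.
by move: yz; rewrite -ball_normE /= distrC => /ltW.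
Qed.

Lemma closed_norm_le (K : numFieldType) (V : normedModType K) (c : K) :
  closed [set y : V | `|y| <= c].
Proof.
have := @closed_dist_le K V 0 c; congr closed.
by apply/seteqP; split=> y /=; rewrite sub0r normrN.
Qed.

(** One step of the nested ball construction in Baire's theorem.  A minimum of
radii need not make sense in a partially ordered field, so the smallness
requirement [e] is put on the distances from the centre of the new ball, and
not on its radius. *)
Lemma ball_avoiding_closed (K : numFieldType) (U : normedModType K)
    (F : set U) (a : U) (r e : {posnum K}) :
  closed F -> F° = set0 ->
  exists (b : U) (s : {posnum K}), forall y, `|b - y| <= s%:num ->
    [/\ `|a - y| <= r%:num, `|b - y| < e%:num & ~ F y].
Proof.
move=> clF F0.
(* Otherwise the centre [a] would be interior to [F]. *)
have [b [abr Fb]] : exists b, ball a r%:num b /\ ~ F b.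
  apply: contrapT => nb; suff : F° a by rewrite F0.
  apply/nbhs_ballP; exists r%:num => //= y ay.
  by apply: contrapT => Fy; apply: nb; exists y.
have : nbhs b (ball a r%:num `&` ball b e%:num `&` ~` F).
  apply: filterI; first apply: filterI.
  - by apply: open_nbhs_nbhs; split=> //; exact: ball_open.
  - exact: nbhsx_ballx.
  - by apply: open_nbhs_nbhs; split=> //; exact: closed_openC.
rewrite -nbhs_ballE => -[s /= s0 bs].
have s20 : 0 < s / 2 by rewrite divr_gt0.
exists b, (PosNum s20) => y /= bys.
have [|[]] := bs y; rewrite -ball_normE /=.
  rewrite (le_lt_trans bys)//.
  by rewrite ltr_pdivrMr// mulr_natr mulr2n ltrDl.
by move=> /ltW.
Qed.

(** If no [F i] had interior, nested closed balls could be chosen whose centres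
form a Cauchy sequence and which avoid the sets [F i] one after the other; the
limit of the centres would lie in no [F i]. *)
Lemma baire_closed_cover (K : numFieldType) (U : completeNormedModType K)
    (I : countType) (F : I -> set U) :
  archimedean_scale K -> (forall i, closed (F i)) ->
  (forall x, exists i, F i x) -> exists i, (F i)° !=set0.
Proof.
move=> archK clF covF; apply: contrapT => noint.
have F0 i : (F i)° = set0.
  by apply/eqP/negPn/negP => /set0P Fi; apply: noint; exists i.
(* The sets [F i] listed along the integers, with padding by [set0]. *)
pose A n := if unpickle n is Some i then F i else set0.
have clA n : closed (A n).
  by rewrite /A; case: unpickle => [i|]; [exact: clF | exact: closed0].
have A0 n : (A n)° = set0.
  by rewrite /A; case: unpickle => [i|]; [exact: F0 | exact: interior0].
(* A point of [U * {posnum K}] stands for a closed ball. *)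
pose step (n : nat) (p q : U * {posnum K}) := forall y,
  `|q.1 - y| <= q.2%:num ->
  [/\ `|p.1 - y| <= p.2%:num, `|q.1 - y| < n.+1%:R^-1 & ~ A n y].
have /choice[next nextP] (np : nat * (U * {posnum K})) :
    exists q, step np.1 np.2 q.
  case: np => n [a r].
  have n1 : 0 < n.+1%:R^-1 :> K by rewrite invr_gt0.
  have [b [s bs]] := ball_avoiding_closed a r (PosNum n1) (clA n) (A0 n).
  by exists (b, s).
pose p := fix p n := if n is m.+1 then next (m, p m) else (0 : U, PosNum (@ltr01 K)).
have pS n : step n (p n) (p n.+1) by exact: (nextP (n, p n)).
pose B n := [set y : U | `|(p n).1 - y| <= (p n).2%:num].
have BS n : B n.+1 `<=` B n by move=> y /pS[].
have Bsub n m : (n <= m)%N -> B m `<=` B n.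
  elim: m => [|m IH]; first by rewrite leqn0 => /eqP ->.
  rewrite leq_eqVlt => /predU1P[-> //|nm].
  by move=> y /BS; exact: (IH nm y).
have Bp n m : (n <= m)%N -> B n (p m).1.
  by move=> nm; apply: (Bsub _ _ nm); rewrite /B /= subrr normr0.
pose a n := (p n).1.
have cvga : cvg (a @ \oo).
  apply: cauchy_cvg; apply: cauchy_exP => e /archK[n ne].
  exists (a n.+1); exists n.+1 => // m /= nm.
  rewrite -ball_normE /=; apply: lt_trans ne.
  by have [] := pS n _ (Bp _ _ nm).
have limB n : B n (lim (a @ \oo)).
  apply: (@closed_cvg _ _ \oo _ a (B n)) => //.
    exact: closed_dist_le.
  by exists n => // m /= /Bp.
have [i Fi] := covF (lim (a @ \oo)).
by have [_ _] := pS _ _ (limB (pickle i).+1); rewrite /A pickleK.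
Qed.

(** * Condensation of singularities *)

(** The vectors at which a given [T n] is bounded form a linear subspace, and
these subspaces cover [V].  Such a subspace is not closed in general; it is the
union over [c] of the closed sets [F (n, c)], so Baire's theorem makes one of
these subspaces contain a ball, hence be the whole of [V]. *)
Lemma condensation_bounded (K : numFieldType) (V : completeNormedModType K)
    (W : normedModType K) (T : nat -> set (V -> W)) :
  archimedean_scale K ->
  (forall n f, T n f -> linear f /\ continuous f) ->
  (forall x, exists n (M : K), forall f, T n f -> `|f x| <= M) ->
  exists n, forall x, exists M : K, forall f, T n f -> `|f x| <= M.
Proof.
move=> archK Tlin Tbd.
pose F (nc : nat * nat) :=
  [set x : V | forall f, T nc.1 f -> `|f x| <= nc.2%:R].
have clF nc : closed (F nc).
  rewrite (_ : F nc = \bigcap_(f in T nc.1) (f @^-1` [set y | `|y| <= nc.2%:R])).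
    apply: closed_bigI => f /Tlin[_ cf].
    by apply: preimage_closed; [move=> x _; exact: cf | exact: closed_norm_le].
  by apply/seteqP; split=> x; rewrite /F /bigcap /=.
have covF x : exists nc, F nc x.
  have [n [M fM]] := Tbd x.
  have [c Mc] : exists c : nat, `|M| <= c%:R.
    have [c Mc] : exists c : nat, c.+1%:R^-1 < (`|M| + 1)^-1.
      by apply: archK; rewrite invr_gt0 ltr_wpDl.
    exists c.+1; move: Mc; rewrite ltf_pV2 ?posrE ?ltr_wpDl// => /ltW.
    by apply: le_trans; rewrite lerDl.
  exists (n, c) => f /= Tf; apply: le_trans Mc; apply: le_trans (fM _ Tf) _.
  by rewrite real_ler_norm// ger0_real// (le_trans _ (fM _ Tf)).
(* All of [T n] is bounded by [c] on a ball around [a]. *)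
have [[n c] [a]] := baire_closed_cover archK clF covF.
rewrite /interior -nbhs_ballE => -[e /= e0 aF]; exists n => x.
(* With this [d] the vector [a + d *: x] remains in the ball, and [f x] is
   recovered from the values of [f] at [a + d *: x] and at [a]. *)
pose d := e / (`|x| + 1).
have x1 : 0 < `|x| + 1 by rewrite ltr_wpDl.
have d0 : 0 < d by rewrite divr_gt0.
exists (d^-1 * (c%:R + c%:R)) => f Tf.
have [lf _] := Tlin _ _ Tf.
have -> : f x = d^-1 *: (f (a + d *: x) - f a).
  rewrite [a + _]addrC lf.
  by rewrite addrK scalerA mulVf ?gt_eqF// scale1r.
rewrite normrZ gtr0_norm ?invr_gt0//.
rewrite ler_pM2l ?invr_gt0//; apply: le_trans (ler_normB _ _) _; rewrite lerD//.
- apply: (aF (a + d *: x)) => //; rewrite -ball_normE /= opprD addNKr normrN normrZ.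
  rewrite gtr0_norm// /d mulrAC -mulrA gtr_pMr// ltr_pdivrMr//.
  by rewrite mul1r ltrDl.
- exact: (aF a (ballxx _ _)).
Qed.

(** * Real and complex scalars *)

Lemma scalar_of_real_le (R : realType) (k : scalars) (a b : R) :
  (scalar_of_real k a <= scalar_of_real k b) = (a <= b).
Proof. by case: k => //=; rewrite lecR. Qed.

Lemma scalar_of_realM (R : realType) (k : scalars) (a b : R) :
  scalar_of_real k (a * b) = scalar_of_real k a * scalar_of_real k b.
Proof. by case: k => //=; rewrite rmorphM. Qed.

Lemma scalar_of_real0 (R : realType) (k : scalars) :
  scalar_of_real k (0 : R) = 0.
Proof. by case: k. Qed.

Lemma rnorm_ge0 (R : realType) (k : scalars)
    (V : normedModType (scalar_field R k)) (v : V) : 0 <= rnorm v.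
Proof.
by rewrite -(scalar_of_real_le k) scalar_of_real0 scalar_of_real_rnorm.
Qed.

Lemma normr_scalar_of_real (R : realType) (k : scalars) (a : R) :
  0 <= a -> `|scalar_of_real k a| = scalar_of_real k a.
Proof.
by case: k => /= a0; rewrite ger0_norm// lecR.
Qed.

Lemma archimedean_scalar_field (R : realType) (k : scalars) :
  archimedean_scale (scalar_field R k).
Proof.
have archR (e : R) : 0 < e -> exists n : nat, n.+1%:R^-1 < e.
  move=> e0; exists (Num.truncn e^-1).
  by rewrite -ltf_pV2 ?(posrE, invr_gt0)// invrK truncnS_gt.
(* A positive complex number is real. *)
case: k => /=; first exact: archR.
move=> [a b]; rewrite ltcE /= => /andP[/eqP -> /archR[n na]]; exists n.
rewrite (_ : n.+1%:R^-1 = (n.+1%:R^-1)%:C%C) ?ltcR//.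
by rewrite fmorphV rmorph_nat.
Qed.

Lemma bounded_linear_continuous_fun (R : realType) (k : scalars)
    (X Y : normedModType (scalar_field R k)) (T : bounded_linear X Y) :
  continuous T.
Proof.
apply: bounded_linear_continuous; apply/bounded_funP => r.
have [C TC] := bounded_linearP T.
exists (scalar_of_real k `|C| * r) => x xr.
rewrite -scalar_of_real_rnorm (le_trans (y := scalar_of_real k (`|C| * rnorm x)))//.
  rewrite scalar_of_real_le (le_trans (TC x))// ler_wpM2r ?ler_norm//.
  exact: rnorm_ge0.
rewrite scalar_of_realM scalar_of_real_rnorm ler_wpM2l//.
by rewrite -normr_scalar_of_real.
Qed.

(** * Hoelder quotients as a family of operators *)

Lemma ereal_sup_ltyP (R : realType) (A : set R) :
  (ereal_sup (EFin @` A) < +oo)%E <-> exists M : R, forall q, A q -> q <= M.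
Proof.
split=> [|[M AM]]; last first.
  apply: (@le_lt_trans _ _ M%:E); last exact: ltry.
  by apply: ge_ereal_sup => _ [q /AM qM <-]; rewrite lee_fin.
have Asup q : A q -> (q%:E <= ereal_sup (EFin @` A))%E.
  by move=> Aq; apply: ereal_sup_ubound; exists q.
case: ereal_sup Asup => [M| |] Asup // _.
  by exists M => q /Asup; rewrite lee_fin.
by exists 0 => q /Asup.
Qed.

(** The operators whose pointwise boundedness expresses the Hoelder condition;
the norm of such an operator's value at [x] is a Hoelder quotient of the orbit
of [x]. *)
Definition difference_quotients (R : realType) (k : scalars)
    (X Y : normedModType (scalar_field R k)) (alpha : R)
    (u : {nonneg R} -> bounded_linear X Y) (K : set R) : set (X -> Y) :=
  [set f | exists r s : {nonneg R},
     [/\ K r%:num, K s%:num, r%:num < s%:num &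
         f = fun x => scalar_of_real k ((s%:num - r%:num) `^ alpha)^-1 *:
                      (u s x - u r x)]].

Lemma difference_quotients_linear_continuous (R : realType) (k : scalars)
    (X Y : normedModType (scalar_field R k)) (alpha : R)
    (u : {nonneg R} -> bounded_linear X Y) (K : set R) (f : X -> Y) :
  difference_quotients alpha u K f -> linear f /\ continuous f.
Proof.
move=> [r [s [_ _ _ ->]]]; split.
  move=> a x y; rewrite (linearP (u s)) (linearP (u r)) opprD addrACA -scalerBr scalerDr.
  by rewrite !scalerA mulrC.
move=> x; apply: cvgZr; apply: cvgB; exact: bounded_linear_continuous_fun.
Qed.

Lemma hoelder_on_bounded_difference_quotients (R : realType) (k : scalars)
    (X Y : normedModType (scalar_field R k)) (alpha : R)
    (u : {nonneg R} -> bounded_linear X Y) (K : set R) (x : X) :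
  (ereal_sup (EFin @` hoelder_quotients alpha K (orbit_at u x)) < +oo)%E <->
  exists M, forall f, difference_quotients alpha u K f -> `|f x| <= M.
Proof.
have normE r s : `|scalar_of_real k ((s%:num - r%:num) `^ alpha)^-1 *:
    (u s x - u r x)| = scalar_of_real k
      (rnorm (orbit_at u x s - orbit_at u x r) / (s%:num - r%:num) `^ alpha).
  rewrite normrZ normr_scalar_of_real ?invr_ge0 ?powR_ge0//.
  by rewrite -scalar_of_real_rnorm -scalar_of_realM mulrC.
rewrite ereal_sup_ltyP; split=> -[M bM].
  exists (scalar_of_real k M) => _ [r [s [Kr Ks rs ->]]].
  by rewrite normE scalar_of_real_le; apply: bM; exists r, s.
(* The bound [M] may be any element of the scalar field; an element of [R[i]]
   above a real number is itself real, so its real part is a bound. *)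
exists (scalar_Re M) => q [r [s [Kr Ks rs ->]]].
have := bM _ (ex_intro _ r (ex_intro _ s (And4 Kr Ks rs erefl))).
rewrite normE; move: (_ / _) => q'.
case: k {X Y u x normE bM r s Kr Ks rs} M => //= -[a b].
by rewrite lecE /= => /andP[].
Qed.

(** * A common time for all orbits *)

Theorem proposition3p5 (R : realType) (k : scalars)
    (X Y : completeNormedModType (scalar_field R k)) (alpha : R)
    (alpha_gt0 : 0 < alpha) (alpha_le1 : alpha <= 1)
    (u : {nonneg R} -> bounded_linear X Y) :
  (forall x : X, exists t : R, 0 <= t /\
     locally_hoelder_on alpha `]t, +oo[ (orbit_at u x))
  <->
  (exists t : R, 0 <= t /\
     forall x : X, locally_hoelder_on alpha `]t, +oo[ (orbit_at u x)).
Proof.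
split=> [orbx|[t [t0 orbt]] x]; last by exists t.
apply: contrapT => nounif.
have /choice[K badK] (n : nat) : exists K : set R,
    [/\ compact K, is_interval K, K `<=` `]n%:R, +oo[ &
        ~ forall x, (ereal_sup (EFin @`
             hoelder_quotients alpha K (orbit_at u x)) < +oo)%E].
  apply: contrapT => noK; apply: nounif; exists n%:R; split=> // x K cK iK Kn.
  by apply: contrapT => supK; apply: noK; exists K; split=> // /(_ x).
(* One of the families is bounded at every vector, against its choice. *)
have [||n bdn] := @condensation_bounded _ X Y
    (fun n => difference_quotients alpha u (K n)) (@archimedean_scalar_field R k).
- by move=> n f; exact: difference_quotients_linear_continuous.
- move=> x; have [t [t0 orbt]] := orbx x.
  exists (Num.truncn t).+1; have [cK iK Kn _] := badK (Num.truncn t).+1.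
  apply/hoelder_on_bounded_difference_quotients; apply: orbt => // s /Kn /=.
  by rewrite !in_itv /= !andbT; apply: lt_trans; exact: truncnS_gt.
have [_ _ _] := badK n; apply=> x.
exact/hoelder_on_bounded_difference_quotients.
Qed.
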